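(* If $n\ge 4$, then the constructible region $\psi_n\subset\mathbb{R}^{2^n-1}$ is not convex.
   Context: Write $[n]=\{1,\dots,n\}$ and let $e_1,\dots,e_n$ be the standard basis of $\mathbb{R}^n$. A body in $\mathbb{R}^n$ is a compact subset $T\subset\mathbb{R}^n$. For non-empty $A\subset[n]$, $T_A$ denotes the orthogonal projection of $T$ onto $\mathrm{Span}(A)=\mathrm{span}\{e_i: i\in A\}$, and $|T_A|$ denotes its $|A|$-dimensional volume (Lebesgue measure in $\mathrm{Span}(A)$). Vectors in $\mathbb{R}^{2^n-1}$ have coordinates indexed by the non-empty subsets of $[n]$. A vector $x\in\mathbb{R}^{2^n-1}$ is constructible if there is a body $T\subset\mathbb{R}^n$ (necessarily with $|T_A|>0$ for all non-empty $A$) such that $x_A=\log|T_A|$ for every non-empty $A\subset[n]$. The constructible region is $\psi_n=\{x\in\mathbb{R}^{2^n-1}: x \text{ is constructible}\}$. *)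

(* Defs.v *)
From HB Require Import structures.
From mathcomp Require Import all_boot all_order all_algebra.
From mathcomp Require Import all_classical all_reals all_analysis.

Set Implicit Arguments.
Unset Strict Implicit.
Unset Printing Implicit Defensive.

Import Order.TTheory GRing.Theory Num.Theory.
Import numFieldNormedType.Exports.

Local Open Scope classical_set_scope.
Local Open Scope ring_scope.

(* Lebesgue measure on R^k, realised on k-tuples (the types on which the
   library puts the product sigma-algebra): the k-fold product of
   lebesgue_measure, transported along R * R^k = R^(k+1). *)
Fixpoint lebesgue_measure_tuple (R : realType) (k : nat) :
    set (k.-tuple (measurableTypeR R)) -> \bar R :=
  match k with
  | 0 => dirac [tuple]
  | k'.+1 =>
      pushforward (product_measure1 lebesgue_measure
                     (@lebesgue_measure_tuple R k'))
        (fun p : measurableTypeR R * k'.-tuple (measurableTypeR R) =>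
           [tuple of p.1 :: p.2])
  end.

Section lebesgue_measure_tuple_measure.
Local Open Scope ereal_scope.
Variable R : realType.
Implicit Types k : nat.

Let T k := k.-tuple (measurableTypeR R).
Let cons_tuple k (p : measurableTypeR R * T k) : T k.+1 :=
  [tuple of p.1 :: p.2].
Let uncons_tuple k (t : T k.+1) : measurableTypeR R * T k :=
  (thead t, [tuple of behead t]).

Let measurable_cons_tuple k : measurable_fun setT (@cons_tuple k).
Proof. by apply: measurable_cons. Qed.

Let measurable_uncons_tuple k : measurable_fun setT (@uncons_tuple k).
Proof.
apply: measurable_fun_pair; first exact: measurable_tnth.
exact: measurable_behead.
Qed.

Let cons_tupleK k : cancel (@cons_tuple k) (@uncons_tuple k).
Proof. by move=> [x t]; congr pair; apply/val_inj. Qed.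

Let pushforwardP k (m : {sigma_finite_measure set (T k) -> \bar R})
    (p := pushforward (lebesgue_measure \x m) (@cons_tuple k)) :
  [/\ p set0 = 0, forall A, 0 <= p A, semi_sigma_additive p
    & sigma_finite setT p].
Proof.
pose M0 : {measure set _ -> \bar R} := pushforward (lebesgue_measure \x m)
  (@cons_tuple k).
pose M := M0 (@measurable_cons_tuple k).
have ME : M = p :> (set _ -> \bar R) by [].
split; rewrite -?ME; [exact: measure0|exact: measure_ge0| |].
  exact: measure_semi_sigma_additive.
have /sigma_finiteP[F [TF ndF Foo]] := sigma_finiteT (@lebesgue_measure R).
have /sigma_finiteP[G [TG ndG Goo]] := sigma_finiteT m.
pose H i := F i `*` G i.
have HT : setT = \bigcup_i H i.
  rewrite -setXTT TF TG; apply/seteqP; split => -[x t] /=.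
    move=> [[i _ Fix] [j _ Gjt]]; exists (maxn i j) => //; split.
      by move: x Fix; exact/subsetPset/ndF/leq_maxl.
    by move: t Gjt; exact/subsetPset/ndG/leq_maxr.
  by move=> [i _ [Fix Git]]; split; exists i.
exists (fun i => @uncons_tuple k @^-1` H i).
  by rewrite -preimage_bigcup -HT preimage_setT.
move=> i; have [mFi Fioo] := Foo i; have [mGi Gioo] := Goo i; split.
  rewrite -[X in measurable X]setTI; apply: measurable_uncons_tuple => //.
  exact: measurableX.
rewrite ME /p /pushforward -comp_preimage.
rewrite (_ : _ \o _ = id); last by apply/funext; exact: cons_tupleK.
by rewrite [ltLHS]product_measure1E// lte_mul_pinfty// ge0_fin_numE.
Qed.

Let lebesgue_measure_tupleP k (p := @lebesgue_measure_tuple R k) :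
  [/\ p set0 = 0, forall A, 0 <= p A, semi_sigma_additive p
    & sigma_finite setT p].
Proof.
rewrite {}/p; elim: k => [|k [m0 mge0 msa msf]].
  split; [exact: measure0|exact: measure_ge0|
          exact: measure_semi_sigma_additive|exact: sigma_finiteT].
pose Hm := isMeasure.Build _ (T k) R (@lebesgue_measure_tuple R k) m0 mge0 msa.
pose m : {measure set (T k) -> \bar R} := HB.pack (@lebesgue_measure_tuple R k) Hm.
pose Hs := @Measure_isSigmaFinite.Build _ (T k) R m msf.
exact: (pushforwardP (HB.pack (Measure.sort m) Hm Hs)).
Qed.

HB.instance Definition _ k := @isMeasure.Build _ (T k) R
  (@lebesgue_measure_tuple R k)
  (let: And4 h _ _ _ := lebesgue_measure_tupleP k in h)
  (let: And4 _ h _ _ := lebesgue_measure_tupleP k in h)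
  (let: And4 _ _ h _ := lebesgue_measure_tupleP k in h).

HB.instance Definition _ k := @Measure_isSigmaFinite.Build _ (T k) R
  (@lebesgue_measure_tuple R k)
  (let: And4 _ _ _ h := lebesgue_measure_tupleP k in h).

Lemma lebesgue_measure_tuple_box k (B : 'I_k -> set (measurableTypeR R)) :
  (forall i, measurable (B i)) ->
  lebesgue_measure_tuple [set t : T k | forall i, B i (tnth t i)] =
  \prod_(i < k) lebesgue_measure (B i).
Proof.
elim: k B => [|k IH] B mB.
  rewrite big_ord0 /= diracE (_ : _ \in _ = true)//.
  by apply/mem_set => -[].
rewrite big_ord_recl -(IH (B \o lift ord0))//= -product_measure1E//; last first.
  rewrite (_ : [set t | _] = \big[setI/setT]_(i < k)
    ((fun t : T k => tnth t i) @^-1` B (lift ord0 i))).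
    apply: bigsetI_measurable => i _; rewrite -[X in measurable X]setTI.
    exact: measurable_tnth.
  apply/seteqP; split => t /=; first by move=> tB; rewrite -bigcap_seq => i _; apply: tB.
  by rewrite -bigcap_seq => tB i; apply: tB; rewrite /= mem_index_enum.
rewrite /pushforward; congr (_ _); apply/seteqP; split => -[x t] /=.
  move=> xtB; split; first exact: (xtB ord0).
  by move=> i; have := xtB (lift ord0 i); rewrite tnthS.
move=> [xB tB] i; case: (unliftP ord0 i) => [j ->|->]; last exact: xB.
by rewrite tnthS; exact: tB.
Qed.

End lebesgue_measure_tuple_measure.

Section constructible.
Variables (R : realType) (n : nat).

(* Coordinates on Span(A) in the orthonormal basis (e_i)_{i in A}; the
   |A|-dimensional volume of a subset of Span(A) is read off through them. *)
Definition span_vec (A : {set 'I_n}) (t : #|A|.-tuple (measurableTypeR R)) :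
    'rV[R]_n :=
  \sum_(k < #|A|) tnth t k *: delta_mx 0 (enum_val k).

Definition span_volume (A : {set 'I_n}) (S : set 'rV[R]_n) : \bar R :=
  lebesgue_measure_tuple (@span_vec A @^-1` S).

Definition span_proj (A : {set 'I_n}) (x : 'rV[R]_n) : 'rV[R]_n :=
  \sum_(i in A) x 0 i *: delta_mx 0 i.

Definition nonempty_subset : finType := {A : {set 'I_n} | A != finset.set0}.

(* R^o makes the function space an R-module. *)
Definition constructible_space : lmodType R :=
  {ffun nonempty_subset -> R^o}.

(* lne 0 = -oo, so the equation in \bar R forces 0 < |T_A| < +oo. *)
Definition constructible (x : constructible_space) : Prop :=
  exists2 T : set 'rV[R]_n, compact T &
    forall A : nonempty_subset,
      ((x A)%:E = lne (span_volume (val A) (span_proj (val A) @` T)))%E.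

Definition constructible_region : set constructible_space :=
  [set x | constructible x].

End constructible.

Arguments constructible_region : clear implicits.

(* Main.v *)
Require Import Defs.
From mathcomp Require Import all_boot all_order all_algebra finmap.
From mathcomp Require Import all_classical all_reals all_analysis.
From mathcomp Require Import measurable_realfun ring lra.

(* Let a and b bound |T_3| and |T_4|.  If h(y) and k(x) are the lengths of the
   slices of T_23 and T_14 over y and x, then h <= a, k <= b, hence
     b h(y) + a k(x) <= a b + h(y) k(x);
   integrating over T_12 gives, for every body T,
     b |T_123| + a |T_124| <= a b |T_12| + |T_23| |T_14|.
   Take the unit cube, with log vector 0, and a union of boxes with
   |T_123|, |T_124| >= 1/4, |T_23|, |T_14| <= 1/4, |T_12| <= 1/2,
   |T_3|, |T_4| <= 1.  A body realising the midpoint of the two log vectors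
   has the square roots of these volumes, so the inequality would give
   1/2 + 1/2 <= sqrt (1/2) + 1/4, which is false. *)

Set Implicit Arguments.
Unset Strict Implicit.
Unset Printing Implicit Defensive.

Import Order.TTheory GRing.Theory Num.Theory.
Import numFieldNormedType.Exports.

Local Open Scope classical_set_scope.
Local Open Scope ring_scope.

(** * Measurability of preimages of compact sets *)

(* A compact set is a countable intersection of finite unions of balls, and a
   ball of a matrix space is a product of balls of R. *)
Lemma compact_measurable_preimage (R : realType) (m n : nat) d
    (T : measurableType d) (g : T -> 'M[R]_(m, n)) (K : set 'M[R]_(m, n)) :
  compact K ->
  (forall i j, measurable_fun setT (fun t => g t i j : measurableTypeR R)) ->
  measurable (g @^-1` K).
Proof.
move=> cK mg.
have cover (k : nat) : exists F : {fset 'M[R]_(m, n)},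
    [set` F] `<=` K /\ K `<=` cover [set` F] (fun c => ball c k.+1%:R^-1).
  have := cK; rewrite compact_cover => /(_ 'M[R]_(m, n) K
    (fun c => ball c k.+1%:R^-1)) [c _||F FK KF].
  - exact: ball_open.
  - by move=> c Kc; exists c => //; exact: ballxx.
  - by exists F; split => // c /FK /set_mem.
have [F HF] := choice cover.
have -> : g @^-1` K =
    \bigcap_k \bigcup_(c in [set` F k]) (g @^-1` ball c k.+1%:R^-1).
  apply/seteqP; split => t /= Kt.
    by move=> k _; have [c Fc ct] := (HF k).2 _ Kt; exists c.
  (* The centres were chosen in [K], so a point lying in every cover is a limit of points of [K]. *)
  have clK := compact_closed (@norm_hausdorff _ _) cK.
  apply: clK => B /nbhs_ballP[e /= e0 eB].
  have [k _ ke] := near_infty_natSinv_lt (PosNum e0).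
  have [c Fc ct] := Kt k I; exists c; split; first exact: (HF k).1.
  apply: eB; apply: ball_sym; apply: le_ball ct.
  exact/ltW/(ke k)/leqnn.
apply: bigcapT_measurable => k; apply: fin_bigcup_measurable => // c _.
rewrite (_ : g @^-1` _ = \big[setI/setT]_(i < m) \big[setI/setT]_(j < n)
  ((fun t => g t i j) @^-1` ball (c i j) k.+1%:R^-1)).
  apply: bigsetI_measurable => i _; apply: bigsetI_measurable => j _.
  rewrite -[X in measurable X]setTI; apply: mg => //.
  exact: measurable_ball.
apply/seteqP; split => t /=.
  move=> [_ ct]; rewrite -bigcap_seq => i _; rewrite -bigcap_seq => j _.
  exact: ct.
move=> ct; split => // i j; move: ct; rewrite -bigcap_seq.
move/(_ i (mem_index_enum _)); rewrite -bigcap_seq.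
by move/(_ j (mem_index_enum _)).
Qed.

(** * Projections of bodies in coordinates *)

Section shadow.
Variables (R : realType) (n : nat).
Implicit Types (T : set 'rV[R]_n).

(* For s = enum A these are the coordinates of the projection T_A. *)
Definition shadow k (s : seq 'I_n) T : set (k.-tuple (measurableTypeR R)) :=
  [set t | exists2 x, T x & t = [seq x 0 i | i <- s] :> seq R].

Definition volume T (A : {set 'I_n}) : \bar R :=
  span_volume A (span_proj A @` T).

(** [s] and [k] are kept free so that an explicit list and a literal dimension can replace [enum A]
    and [#|A|], on which the tuple type depends. *)
Lemma volumeE T (A : {set 'I_n}) k (s : seq 'I_n) :
  enum A = s -> size s = k ->
  volume T A = lebesgue_measure_tuple (@shadow k s T).
Proof.
move=> <-; rewrite -cardE => <-; rewrite /volume /span_volume; congr (_ _).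
apply/seteqP; split => t /= [x Tx].
  move=> xt; exists x => //; apply: (@eq_from_nth _ 0).
    by rewrite size_tuple size_map -cardE.
  move=> i; rewrite size_tuple => iA.
  rewrite (nth_map (enum_val (Ordinal iA))) -?cardE//.
  rewrite -(enum_val_nth _ (Ordinal iA)).
  have /(congr1 (fun z : 'rV[R]_n => z 0 (enum_val (Ordinal iA)))) := xt.
  rewrite /span_proj /span_vec !summxE.
  rewrite (bigD1 (enum_val (Ordinal iA))) ?enum_valP//=.
  rewrite big1 ?addr0; last first.
    by move=> j /andP[_ ji]; rewrite !mxE eqxx eq_sym (negPf ji) mulr0.
  rewrite !mxE !eqxx mulr1 => ->.
  rewrite (bigD1 (Ordinal iA))//= big1 ?addr0.
    by rewrite !mxE !eqxx mulr1 (tnth_nth 0).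
  move=> j ji; rewrite !mxE eqxx (inj_eq enum_val_inj) eq_sym (negPf ji).
  by rewrite mulr0.
move=> xt; exists x => //; rewrite /span_proj /span_vec big_enum_val.
apply: eq_bigr => i _; congr (_ *: _).
rewrite (tnth_nth 0) xt (nth_map (enum_val i)) -?cardE ?ltn_ord//.
by rewrite -enum_val_nth.
Qed.

(** Once tuples are read as row vectors, a shadow is the preimage of a continuous image of [T],
    which is compact. *)
Lemma measurable_shadow k s T : size s = k -> compact T ->
  measurable (@shadow k s T).
Proof.
(* For [k = 0] there may be no index to serve as default for [nth]; a set of 0-tuples is empty or
   full. *)
move=> sk cT; case: k sk => [|k] sk.
  have [[x Tx]|T0] := pselect (T !=set0).
    rewrite (_ : shadow _ _ = setT)//; apply/seteqP; split=> //= t _.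
    by exists x => //; rewrite (size0nil sk) [t]tuple0.
  rewrite (_ : shadow _ _ = set0)//; apply/seteqP; split=> //= t [x Tx].
  by case: T0; exists x.
have i0 : 'I_n by case: s sk.
pose f (x : 'rV[R]_n) : 'rV[R]_k.+1 := \row_j x 0 (nth i0 s j).
have cf : continuous f.
  move=> x B /nbhs_ballP[e /= e0 eB].
  suff : nbhs x (f @^-1` B) by [].
  apply/nbhs_ballP; exists e => // y [_ xy]; apply: eB; split => // i j.
  by rewrite !mxE.
pose g (t : k.+1.-tuple (measurableTypeR R)) : 'rV[R]_k.+1 := \row_j tnth t j.
rewrite (_ : shadow _ _ = g @^-1` (f @` T)).
  apply: compact_measurable_preimage.
    by apply: continuous_compact => //; exact: continuous_subspaceT.
  by move=> i j; under eq_fun do rewrite mxE; exact: measurable_tnth.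
apply/seteqP; split => t /= [x Tx] xt; exists x => //.
  by apply/rowP => j; rewrite !mxE (tnth_nth 0) xt (nth_map i0)// sk.
apply: (@eq_from_nth _ 0); first by rewrite size_tuple size_map.
move=> i; rewrite size_tuple => ik; rewrite (nth_map i0) ?sk//.
move/rowP/(_ (Ordinal ik)): xt; by rewrite !mxE (tnth_nth 0) => <-.
Qed.

End shadow.
Arguments shadow {R n} k s T.

(** * Fubini for tuples and the volume inequality for measurable sets *)

Section slicing.
Local Open Scope ereal_scope.
Variable R : realType.
Implicit Types k : nat.

Definition slice k (x : measurableTypeR R)
    (X : set (k.+1.-tuple (measurableTypeR R))) :
    set (k.-tuple (measurableTypeR R)) :=
  [set t : k.-tuple (measurableTypeR R) | X [tuple of x :: t]].

Lemma measurable_slice k x (X : set (k.+1.-tuple (measurableTypeR R))) :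
  measurable X -> measurable (slice x X).
Proof.
move=> mX; rewrite -[slice x X]setTI.
apply: (measurable_cons (f := cst x) (g := id)) => //.
Qed.

Lemma lebesgue_measure_tupleS k (X : set (k.+1.-tuple (measurableTypeR R))) :
  lebesgue_measure_tuple X =
  \int[lebesgue_measure]_x lebesgue_measure_tuple (slice x X).
Proof.
rewrite /= /pushforward /product_measure1; apply: eq_integral => x _ /=.
by congr (_ _); apply/seteqP; split => t => [/xsectionP//|Xt]; exact/xsectionP.
Qed.

Lemma measurable_fun_slice k (X : set (k.+1.-tuple (measurableTypeR R))) :
  measurable X ->
  measurable_fun setT (fun x => lebesgue_measure_tuple (slice x X)).
Proof.
move=> mX.
pose f (p : measurableTypeR R * k.-tuple (measurableTypeR R)) :=
  [tuple of p.1 :: p.2].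
have mf : measurable_fun setT f by exact: measurable_cons.
have := measurable_fun_xsection (@lebesgue_measure_tuple R k)
  (mf measurableT _ mX).
apply: eq_measurable_fun => x _ /=; congr (_ _).
rewrite setTI; apply/seteqP; split => t => [/xsectionP|Xt] //; exact/xsectionP.
Qed.

(** Used to integrate the inequality between slices over the first coordinate. Nonnegativity stands
    in for integrability, so infinite integrals are allowed. *)
Lemma ge0_le_integral_comb d (T : measurableType d)
    (mu : {measure set T -> \bar R}) (a b c e : \bar R)
    (f g h k : T -> \bar R) :
  0 <= a -> 0 <= b -> 0 <= c -> 0 <= e ->
  (forall x, 0 <= f x) -> (forall x, 0 <= g x) ->
  (forall x, 0 <= h x) -> (forall x, 0 <= k x) ->
  measurable_fun setT f -> measurable_fun setT g ->
  measurable_fun setT h -> measurable_fun setT k ->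
  (forall x, a * f x + b * g x <= c * h x + e * k x) ->
  a * \int[mu]_x f x + b * \int[mu]_x g x <=
  c * \int[mu]_x h x + e * \int[mu]_x k x.
Proof.
move=> a0 b0 c0 e0 f0 g0 h0 k0 mf mg mh mk fghk.
have mM z (u : T -> \bar R) : measurable_fun setT u ->
    measurable_fun setT (fun x => z * u x) by exact: measurable_funeM.
rewrite -!ge0_integralZl// -!ge0_integralD//; try exact: mM.
- apply: ge0_le_integral => //; last by apply: emeasurable_funD; exact: mM.
  + by move=> x _; rewrite adde_ge0// mule_ge0.
  + by apply: emeasurable_funD; exact: mM.
all: by move=> x _; rewrite mule_ge0.
Qed.

(* For real r this is (a r - p) (b - k) >= 0. *)
Lemma le_slice_arith (a b : R) (P p Q r k v : \bar R) :
  (0 < a)%R -> (0 < b)%R -> 0 <= p -> 0 <= k -> 0 <= r ->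
  P <= p -> p <= a%:E * r -> p <= v -> Q <= r * k -> k <= b%:E ->
  b%:E * P + a%:E * Q <= (a * b)%:E * r + v * k.
Proof.
move=> a0 b0 p0 k0 r0 Pp par pv Qrk kb.
have vk0 : 0 <= v * k by rewrite mule_ge0// (le_trans p0).
case: r r0 par Qrk => [r| |//] r0 par Qrk; last first.
  (* For [r = +oo] the right side is [+oo], since [v * k] is nonnegative. *)
  rewrite gt0_muley ?lte_fin ?mulr_gt0// addye ?leey//.
  by rewrite gt_eqF// (lt_le_trans _ vk0).
have kfin : k \is a fin_num by rewrite ge0_fin_numE// (le_lt_trans kb) ?ltry.
have pfin : p \is a fin_num.
  by rewrite ge0_fin_numE// (le_lt_trans par)// -EFinM ltry.
(* Raising [P] to [p] and [Q] to [r * k], and lowering [v] to [p], leaves exactly the expanded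
   product. *)
apply: (@le_trans _ _ (b%:E * p + a%:E * (r%:E * k))).
  by rewrite leeD// lee_wpmul2l// lee_fin ltW.
apply: (@le_trans _ _ ((a * b)%:E * r%:E + p * k)); last first.
  by rewrite leeD2l// lee_wpmul2r.
move: par kb k0 p0; rewrite -(fineK kfin) -(fineK pfin) -!EFinM -!EFinD.
rewrite !lee_fin.
nra.
Qed.

Lemma le_lebesgue_measure_tuple k (X Y : set (k.-tuple (measurableTypeR R))) :
  measurable X -> measurable Y -> X `<=` Y ->
  lebesgue_measure_tuple X <= lebesgue_measure_tuple Y.
Proof. by move=> mX mY; apply: le_measure; exact: mem_set. Qed.

Lemma lebesgue_measure_tuple0 (X : set (0.-tuple (measurableTypeR R))) :
  X [tuple] -> lebesgue_measure_tuple X = 1.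
Proof. by move=> X0; rewrite /= diracE mem_set. Qed.

Lemma lebesgue_measure_tuple0_le1 (X : set (0.-tuple (measurableTypeR R))) :
  lebesgue_measure_tuple X <= 1.
Proof. by rewrite /= diracE lee_fin lern1 leq_b1. Qed.

(** The double slice of [Y] consists of 0-tuples, so its measure is the indicator of [Y] at
    [(x, y)]. Either the fibre of [X] is empty or this indicator is 1 and the fibre lies in [Z]. *)
Lemma le_lebesgue_measure_slice k x y
    (X : set (k.+2.-tuple (measurableTypeR R)))
    (Y : set (2.-tuple (measurableTypeR R)))
    (Z : set (k.-tuple (measurableTypeR R))) :
  measurable X -> measurable Z ->
  (forall t : k.-tuple (measurableTypeR R), X [tuple of x :: y :: t] ->
    Y [tuple x; y] /\ Z t) ->
  lebesgue_measure_tuple (slice y (slice x X)) <=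
  lebesgue_measure_tuple (slice y (slice x Y)) * lebesgue_measure_tuple Z.
Proof.
move=> mX mZ XYZ; have [[t Xt]|X0] := pselect (slice y (slice x X) !=set0).
  rewrite [X in _ <= X * _]lebesgue_measure_tuple0 ?mul1e; last first.
    have [Yxy _] := XYZ _ Xt; rewrite /slice /=.
    by congr Y: Yxy; apply: val_inj.
  apply: le_lebesgue_measure_tuple => //; last by move=> u /XYZ[].
  by apply: measurable_slice; exact: measurable_slice.
rewrite (_ : slice y (slice x X) = set0) ?measure0 ?mule_ge0//.
by apply/seteqP; split => // t Xt; case: X0; exists t.
Qed.

(** The bound is proved for each fixed [x] and then integrated in [x]. The volume of [X23] does not
    involve [x], so it acts as a constant coefficient of the slices of [X14]. *)
Lemma slicing_inequality (a b : R) X4 X3 X12 X23 X14 X123 X124 :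
  (0 < a)%R -> (0 < b)%R ->
  measurable X3 -> measurable X4 ->
  measurable X12 -> measurable X23 -> measurable X14 ->
  measurable X123 -> measurable X124 ->
  (forall x y z, X123 [tuple x; y; z] ->
    X12 [tuple x; y] /\ X23 [tuple y; z]) ->
  (forall x y w, X124 [tuple x; y; w] ->
    X12 [tuple x; y] /\ X14 [tuple x; w]) ->
  (forall y z, X23 [tuple y; z] -> X3 [tuple z]) ->
  (forall x w, X14 [tuple x; w] -> X4 [tuple w]) ->
  lebesgue_measure_tuple X3 <= a%:E -> lebesgue_measure_tuple X4 <= b%:E ->
  b%:E * lebesgue_measure_tuple X123 + a%:E * lebesgue_measure_tuple X124 <=
  (a * b)%:E * lebesgue_measure_tuple X12 +
  lebesgue_measure_tuple X23 * lebesgue_measure_tuple X14.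
Proof.
move=> a0 b0 mX3 mX4 mX12 mX23 mX14 mX123 mX124 X123P X124P X23P X14P X3a X4b.
have tuple1 (t : 1.-tuple (measurableTypeR R)) : exists z, t = [tuple z].
  exists (thead t); apply: val_inj.
  by case/tupleP: t => z t; rewrite (tuple0 t).
rewrite (lebesgue_measure_tupleS X123) (lebesgue_measure_tupleS X124).
rewrite (lebesgue_measure_tupleS X12) (lebesgue_measure_tupleS X14).
have mf k (X : set (k.+1.-tuple (measurableTypeR R))) :=
  @measurable_fun_slice k X.
apply: ge0_le_integral_comb => //; try exact: mf.
1-3: by rewrite lee_fin ?mulr_ge0 ?ltW.
move=> x.
(* [p] integrates [h(y)], the length of the slice of [X23] over [y], over the slice of [X12] at [x];
   the first factor is an indicator. *)
pose p := \int[lebesgue_measure]_y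
  (lebesgue_measure_tuple (slice y (slice x X12)) *
   lebesgue_measure_tuple (slice y X23)).
have mX12x : measurable_fun setT
    (fun y => lebesgue_measure_tuple (slice y (slice x X12))).
  by apply: mf; exact: measurable_slice.
have mp : measurable_fun setT (fun y =>
  lebesgue_measure_tuple (slice y (slice x X12)) *
  lebesgue_measure_tuple (slice y X23)).
  by apply: emeasurable_funM => //; exact: mf.
apply: (@le_slice_arith a b _ p) => //.
- by apply: integral_ge0 => y _; exact: mule_ge0.
- rewrite lebesgue_measure_tupleS; apply: ge0_le_integral => //.
    by apply: mf; exact: measurable_slice.
  move=> y _; apply: le_lebesgue_measure_slice => //.
    exact: measurable_slice.
  move=> t; have [z ->] := tuple1 t => Xt; apply: X123P.
  by congr X123: Xt; apply: val_inj.
(* Each slice of [X23] lies in [X3], so [h] is at most [a]. *)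
- rewrite lebesgue_measure_tupleS -ge0_integralZl// ?lee_fin ?(ltW a0)//.
  apply: ge0_le_integral => //.
  - by move=> y _; exact: mule_ge0.
  - exact: measurable_funeM.
  move=> y _; rewrite muleC lee_wpmul2r//.
  apply: le_trans X3a; apply: le_lebesgue_measure_tuple => //.
    exact: measurable_slice.
  move=> t; have [z ->] := tuple1 t => Xt; apply: (X23P y).
  by congr X23: Xt; apply: val_inj.
(* Dropping the indicator leaves the integral of [h] over all [y], the volume of [X23]. *)
- rewrite lebesgue_measure_tupleS; apply: ge0_le_integral => //.
  - by move=> y _; exact: mule_ge0.
  - exact: mf.
  move=> y _; rewrite -[leRHS]mul1e lee_wpmul2r//.
  exact: lebesgue_measure_tuple0_le1.
(* The fibre of [X124] over [(x, y)] lies in the slice of [X14] at [x], a bound independent of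
   [y]. *)
- rewrite (lebesgue_measure_tupleS (slice x X124)).
  rewrite (lebesgue_measure_tupleS (slice x X12)) -ge0_integralZr//.
  apply: ge0_le_integral => //.
  + by apply: mf; exact: measurable_slice.
  + by apply: emeasurable_funM.
  + move=> y _; apply: le_lebesgue_measure_slice => //.
      exact: measurable_slice.
    move=> t; have [z ->] := tuple1 t => Xt; apply: X124P.
    by congr X124: Xt; apply: val_inj.
- apply: le_trans X4b; apply: le_lebesgue_measure_tuple => //.
    exact: measurable_slice.
  move=> t; have [z ->] := tuple1 t => Xt; apply: (X14P x).
  by congr X14: Xt; apply: val_inj.
Qed.
End slicing.

(** * Volumes of bodies and boxes, and the inequality for projections *)

Section bodies.
Variables (R : realType) (n : nat).
Implicit Types (T : set 'rV[R]_n) (A : {set 'I_n}) (s : 'I_n -> R).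

Lemma volumeS T T' A : compact T -> compact T' -> T `<=` T' ->
  (volume T A <= volume T' A)%E.
Proof.
move=> cT cT' TT'; rewrite !(volumeE _ erefl erefl).
apply: le_lebesgue_measure_tuple; try exact: measurable_shadow.
by move=> t [x Tx tx]; exists x => //; exact: TT'.
Qed.

Lemma volumeU T T' A : compact T -> compact T' ->
  (volume (T `|` T') A <= volume T A + volume T' A)%E.
Proof.
move=> cT cT'; rewrite !(volumeE _ erefl erefl).
have -> : shadow (size (enum A)) (enum A) (T `|` T') =
    shadow (size (enum A)) (enum A) T `|` shadow (size (enum A)) (enum A) T'.
  apply/seteqP; split => t.
    by move=> [x [Tx|Tx] tx]; [left|right]; exists x.
  by move=> [[x Tx tx]|[x Tx tx]]; exists x => //; [left|right].
by apply: measureU2; exact: measurable_shadow.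
Qed.

Definition box s : set 'rV[R]_n :=
  [set x | forall i, `[0, s i]%classic (x 0 i)].

Lemma compact_box s : compact (box s).
Proof.
by apply: (@rV_compact _ _ (fun i => `[0, s i]%classic)) => i;
  exact: segment_compact.
Qed.

Lemma subset_box s s' : (forall i, s i <= s' i) -> box s `<=` box s'.
Proof.
move=> ss' x sx i; have := sx i; rewrite /= !in_itv /= => /andP[-> xs].
exact: le_trans (ss' i).
Qed.

Lemma volume_box s A : (forall i, 0 <= s i) ->
  volume (box s) A = (\prod_(i in A) s i)%:E.
Proof.
move=> s0; rewrite (volumeE _ erefl (esym (cardE A))).
have -> : shadow #|A| (enum A) (box s) =
    [set t : #|A|.-tuple (measurableTypeR R) |
      forall k, `[0, s (enum_val k)]%classic (tnth t k)].
  apply/seteqP; split => t.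
    move=> [x bx tx] k; rewrite (tnth_nth 0) tx.
    by rewrite (nth_map (enum_val k)) -?cardE// -enum_val_nth; exact: bx.
  move=> bt.
  (* The tuple is extended by zero outside [A]; zero is admissible there because the sides are
     nonnegative. *)
  exists (\row_i if i \in A then nth 0 t (index i (enum A)) else 0).
    move=> i; rewrite mxE; case: ifPn => [iA|_]; last first.
      by rewrite /= in_itv/= lexx s0.
    have kA : (index i (enum A) < #|A|)%N by rewrite cardE index_mem mem_enum.
    have := bt (Ordinal kA).
    by rewrite (enum_val_nth i) nth_index ?mem_enum// (tnth_nth 0).
  apply: (@eq_from_nth _ 0) => [|k].
    by rewrite size_tuple size_map -cardE.
  rewrite size_tuple => kA; rewrite (nth_map (enum_val (Ordinal kA))) -?cardE//.
  rewrite mxE -(enum_val_nth _ (Ordinal kA)) enum_valP.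
  rewrite (enum_val_nth (enum_val (Ordinal kA))) index_uniq ?enum_uniq//.
  by rewrite -cardE.
transitivity (\prod_(k < #|A|)
    (@lebesgue_measure R `[0%R, s (enum_val k)]%classic : \bar R))%E.
  exact: (@lebesgue_measure_tuple_box R #|A|
    (fun k => `[0, s (enum_val k)]%classic)).
rewrite (eq_bigr (fun k => (s (enum_val k))%:E)) => [|k _].
  by rewrite prodEFin [in RHS]big_enum_val.
(* If [0 < s] fails, the interval formula returns 0, which is then the side itself. Flat boxes are
   thus covered. *)
rewrite lebesgue_measure_itv/= lte_fin sube0; case: ltP => // sk.
by congr EFin; apply/eqP; rewrite eq_le s0.
Qed.

(** [enum A] is filtered from the increasing enumeration of ['I_n], and a strictly increasing list
    is determined by its members. *)
Lemma enum_sorted A (s : seq 'I_n) :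
  sorted (fun i j : 'I_n => i < j)%N s -> A =i s -> enum A = s.
Proof.
move=> ss As; apply: (@irr_sorted_eq _ (fun i j : 'I_n => i < j)%N) => //.
- by move=> ? ? ?; exact: ltn_trans.
- by move=> ?; exact: ltnn.
- rewrite /enum_mem -enumT; apply: sorted_filter.
    by move=> ? ? ?; exact: ltn_trans.
  have := iota_ltn_sorted 0 n; rewrite -val_enum_ord.
  by rewrite sorted_map.
- by move=> i; rewrite mem_enum As.
Qed.

(** The order [i < j < k < l] makes each [enum] list its indices in the order of [x, y, z, w] in
    [slicing_inequality]. *)
Lemma projection_inequality T (i j k l : 'I_n) (a b : R) :
  compact T -> (i < j < k)%N -> (k < l)%N -> 0 < a -> 0 < b ->
  (volume T [set k] <= a%:E)%E -> (volume T [set l] <= b%:E)%E ->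
  (b%:E * volume T [set i; j; k] + a%:E * volume T [set i; j; l] <=
   (a * b)%:E * volume T [set i; j] +
   volume T [set j; k] * volume T [set i; l])%E.
Proof.
move=> cT /andP[ij jk] kl a0 b0.
have jl := ltn_trans jk kl; have il := ltn_trans ij jl.
rewrite (@volumeE R n _ [set k] 1 [:: k]) ?enum_set1//.
rewrite (@volumeE R n _ [set l] 1 [:: l]) ?enum_set1//.
rewrite (@volumeE R n _ [set i; j] 2 [:: i; j])//; last first.
  by apply: enum_sorted => [/=|u]; rewrite ?ij// !inE.
rewrite (@volumeE R n _ [set j; k] 2 [:: j; k])//; last first.
  by apply: enum_sorted => [/=|u]; rewrite ?jk// !inE.
rewrite (@volumeE R n _ [set i; l] 2 [:: i; l])//; last first.
  by apply: enum_sorted => [/=|u]; rewrite ?il// !inE.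
rewrite (@volumeE R n _ [set i; j; k] 3 [:: i; j; k])//; last first.
  by apply: enum_sorted => [/=|u]; rewrite ?ij ?jk// !inE orbA.
rewrite (@volumeE R n _ [set i; j; l] 3 [:: i; j; l])//; last first.
  by apply: enum_sorted => [/=|u]; rewrite ?ij ?jl// !inE orbA.
apply: slicing_inequality => //; try exact: measurable_shadow.
- by move=> x y z [t Tt [-> -> ->]]; split; exists t.
- by move=> x y z [t Tt [-> -> ->]]; split; exists t.
- by move=> y z [t Tt [_ ->]]; exists t.
- by move=> y z [t Tt [_ ->]]; exists t.
Qed.

End bodies.

(** * The union of boxes whose square-root volumes belong to no body *)

Section witness.
Variables (R : realType) (n : nat).
Implicit Types (T : set 'rV[R]_n) (A : {set 'I_n}).

(** The default 1 gives all coordinates after the listed ones unit side, so they never change a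
    product. *)
Definition side (s : seq R) : 'I_n -> R := fun i => nth 1 s i.

(** A contradiction needs [2 sqrt e > sqrt (2 e) + e]; the value 1/4 satisfies this and has a
    rational square root. *)
Let e : R := 1 / 4%:R.

(** The first box gives volume [e] to {1,2,3} and is flat in direction 4; the second gives [e] to
    {1,2,4} and is flat in direction 3. The third makes all projections positive without enlarging
    those on {1,2}, {2,3} and {1,4}. *)
Definition cross : set 'rV[R]_n :=
  box (side [:: 1; e; 1; 0]) `|`
  (box (side [:: e; 1; 0; 1]) `|` box (side [:: e; e; 1; 1])).

Lemma compact_cross : compact cross.
Proof. by do ?[apply: compactU]; exact: compact_box. Qed.

Let cross_le_prod1 s A : (forall i, 0 <= side s i) ->
  cross `<=` box (side s) ->
  (volume cross A <= (\prod_(i in A) side s i)%:E)%E.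
Proof.
move=> s0 cs; rewrite -volume_box//.
by apply: volumeS => //; [exact: compact_cross|exact: compact_box].
Qed.

Let cross_le_prod2 s s' A : (forall i, 0 <= side s i) ->
  (forall i, 0 <= side s' i) ->
  cross `<=` box (side s) `|` box (side s') ->
  (volume cross A <= (\prod_(i in A) side s i + \prod_(i in A) side s' i)%:E)%E.
Proof.
move=> s0 s'0 cs; rewrite EFinD -!volume_box//.
apply: le_trans (volumeU _ _ _); try exact: compact_box.
apply: volumeS => //; first exact: compact_cross.
by apply: compactU; exact: compact_box.
Qed.

Let cross_ge_prod s A : (forall i, 0 <= side s i) ->
  box (side s) `<=` cross ->
  ((\prod_(i in A) side s i)%:E <= volume cross A)%E.
Proof.
move=> s0 cs; rewrite -volume_box//.
by apply: volumeS => //; [exact: compact_box|exact: compact_cross].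
Qed.

Local Ltac sides :=
  rewrite /side; case=> [[|[|[|[|?]]]] ?] /=; rewrite ?nth_nil /e; lra.

Lemma volume_cross_le1 A : (volume cross A <= 1)%E.
Proof.
have -> : 1%E = (\prod_(i in A) side [:: 1; 1; 1; 1] i)%:E :> \bar R.
  by rewrite big1// => -[[|[|[|[|i]]]] ?] _ //=; rewrite /side /= nth_nil.
apply: cross_le_prod1; first sides.
by rewrite /cross !subUset; do ?split; apply: subset_box; sides.
Qed.

Lemma volume_cross_gt0 A : (0 < volume cross A)%E.
Proof.
apply: lt_le_trans (@cross_ge_prod [:: e; e; 1; 1] A _ _); last 2 first.
- sides.
- by move=> x ?; right; right.
by rewrite lte_fin prodr_gt0// => i _; move: i; sides.
Qed.

Let volume_cross_bounds i j k l :
  val i = 0%N -> val j = 1%N -> val k = 2%N -> val l = 3%N ->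
  [/\ (volume cross [set i; j] <= (e *+ 2)%:E)%E,
      (volume cross [set j; k] <= e%:E)%E,
      (volume cross [set i; l] <= e%:E)%E,
      (e%:E <= volume cross [set i; j; k])%E &
      (e%:E <= volume cross [set i; j; l])%E].
Proof.
move=> i0 j1 k2 l3.
have ij : i != j by rewrite -val_eqE i0 j1.
have ik : i != k by rewrite -val_eqE i0 k2.
have il : i != l by rewrite -val_eqE i0 l3.
have jk : j != k by rewrite -val_eqE j1 k2.
have jl : j != l by rewrite -val_eqE j1 l3.
have prod2 s (u v : 'I_n) : u != v ->
    \prod_(w in [set u; v]%SET) side s w = side s u * side s v.
  by move=> uv; rewrite big_setU1 ?big_set1// inE.
have prod3 s (u v w : 'I_n) : u != v -> u != w -> v != w ->
    \prod_(z in [set u; v; w]%SET) side s z = side s u * side s v * side s w.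
  move=> uv uw vw; rewrite -finset.setUA big_setU1 ?prod2//=.
    exact: mulrA.
  by rewrite !inE negb_or uv uw.
split.
(* Enlarging sides outside the index set is free, and lets one of the two covering boxes absorb the
   third box of [cross]. *)
- have := @cross_le_prod2 [:: 1; e; 1; 1] [:: e; 1; 1; 1] [set i; j].
  rewrite !prod2// /side i0 j1 /= mulr1 mul1r -mulr2n; apply; try sides.
  apply: setUSS; first by apply: subset_box; sides.
  by rewrite subUset; split; apply: subset_box; sides.
(* The second box is flat along [k] and contributes nothing; the third is absorbed with the
   first. *)
- have := @cross_le_prod2 [:: 1; e; 1; 1] [:: 1; 1; 0; 1] [set j; k].
  rewrite !prod2// /side j1 k2 /= mulr1 mulr0 addr0; apply; try sides.
  rewrite /cross setUCA setUC; apply: setUSS.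
    by rewrite subUset; split; apply: subset_box; sides.
  by apply: subset_box; sides.
(* Here the first box is flat along [l], and the third is absorbed with the second. *)
- have := @cross_le_prod2 [:: e; 1; 1; 1] [:: 1; 1; 1; 0] [set i; l].
  rewrite !prod2// /side i0 l3 /= mulr1 mulr0 addr0; apply; try sides.
  rewrite /cross setUC; apply: setUSS.
    by rewrite subUset; split; apply: subset_box; sides.
  by apply: subset_box; sides.
- have := @cross_ge_prod [:: 1; e; 1; 0] [set i; j; k].
  rewrite !prod3// /side i0 j1 k2 /= mulr1 mul1r; apply; first sides.
  by move=> x ?; left.
- have := @cross_ge_prod [:: e; 1; 0; 1] [set i; j; l].
  rewrite !prod3// /side i0 j1 l3 /= !mulr1; apply; first sides.
  by move=> x ?; right; left.
Qed.

(** [u] is the square root of the volumes of [cross], fixed by its sign and its square.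
    One-dimensional volumes are at most 1, so [a = b = 1] is allowed in [projection_inequality]. *)
Lemma sqrt_volume_cross_not_body (i j k l : 'I_n) T (u : {set 'I_n} -> R) :
  val i = 0%N -> val j = 1%N -> val k = 2%N -> val l = 3%N ->
  compact T ->
  (forall A, A != finset.set0 -> volume T A = (u A)%:E) ->
  (forall A, A != finset.set0 -> 0 <= u A) ->
  (forall A, A != finset.set0 -> (u A ^+ 2)%:E = volume cross A) -> False.
Proof.
move=> i0 j1 k2 l3 cT Tu u0 uc.
have [] := volume_cross_bounds i0 j1 k2 l3.
have nz (A : {set 'I_n}) z : z \in A -> A != finset.set0.
  by move=> zA; apply/set0Pn; exists z.
have ne1 (z : 'I_n) : [set z]%SET != finset.set0.
  by apply: (nz _ z); rewrite !inE eqxx.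
have ne2 (y z : 'I_n) : [set y; z]%SET != finset.set0.
  by apply: (nz _ z); rewrite !inE eqxx orbT.
have ne3 (x y z : 'I_n) : [set x; y; z]%SET != finset.set0.
  by apply: (nz _ z); rewrite !inE eqxx orbT.
have le1 z : u [set z]%SET <= 1.
  have := volume_cross_le1 [set z]%SET; rewrite -uc// lee_fin => uz.
  by rewrite -(expr_le1 (n := 2))// u0.
have := @projection_inequality R n T i j k l 1 1 cT.
rewrite i0 j1 k2 l3 !Tu// mulr1 !mul1e -!EFinM -!EFinD !lee_fin.
move=> /(_ isT isT ltr01 ltr01 (le1 _) (le1 _)) ineq.
rewrite -!uc// !lee_fin /e => b12 b23 b14 b123 b124.
have v23 : u [set j; k]%SET <= 1 / 2%:R.
  by rewrite -(ler_pXn2r (n := 2)) ?nnegrE ?u0//; lra.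
have v14 : u [set i; l]%SET <= 1 / 2%:R.
  by rewrite -(ler_pXn2r (n := 2)) ?nnegrE ?u0//; lra.
have v123 : 1 / 2%:R <= u [set i; j; k]%SET.
  by rewrite -(ler_pXn2r (n := 2)) ?nnegrE ?u0//; lra.
have v124 : 1 / 2%:R <= u [set i; j; l]%SET.
  by rewrite -(ler_pXn2r (n := 2)) ?nnegrE ?u0//; lra.
have := ler_pM (u0 _ (ne2 j k)) (u0 _ (ne2 i l)) v23 v14.
(* The inequality forces [u [set i; j]] to be at least 3/4, while its square is at most 1/2. *)
nra.
Qed.

End witness.
Arguments cross : clear implicits.

(** * Failure of convexity at the midpoint of two constructible vectors *)

Theorem theorem11 (R : realType) (n : nat) (n_ge4 : (4 <= n)%N) :
  ~ convex_set (M := constructible_space R n) (constructible_region R n).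
Proof.
move=> cvx.
have volE (A : {set 'I_n}) :
    volume (cross R n) A = (fine (volume (cross R n) A))%:E.
  rewrite fineK// ge0_fin_numE ?ltW ?volume_cross_gt0//.
  by rewrite (le_lt_trans (volume_cross_le1 R A))// ltry.
have fine_gt0 (A : {set 'I_n}) : 0 < fine (volume (cross R n) A).
  by rewrite -lte_fin -volE volume_cross_gt0.
pose x : constructible_space R n := 0.
pose y : constructible_space R n :=
  [ffun A => ln (fine (volume (cross R n) (val A)))].
have cx : constructible x.
  exists (box (fun _ => 1)); first exact: compact_box.
  move=> A; rewrite -/(volume _ _) volume_box//.
  by rewrite big1// ffunE lne1.
have cy : constructible y.
  exists (cross R n); first exact: compact_cross.
  by move=> A; rewrite -/(volume _ _) volE lne_EFin// ffunE.
have h0 : 0 <= 2^-1 :> R by lra.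
have h1 : 2^-1 <= 1 :> R by lra.
(* With [y] as first endpoint its coefficient is [2^-1] itself, and the term from [x = 0]
   vanishes. *)
have /set_mem[T cT Tz] := cvx y x (Itv01 h0 h1) (mem_set cy) (mem_set cx).
(* The exponential of half the logarithm is the square root of the volume. *)
pose u (A : {set 'I_n}) := expR (2^-1 * ln (fine (volume (cross R n) A))).
have ltn m (m4 : (m < 4)%N) : (m < n)%N := leq_trans m4 n_ge4.
apply: (@sqrt_volume_cross_not_body R n (Ordinal (ltn 0 isT))
  (Ordinal (ltn 1 isT)) (Ordinal (ltn 2 isT)) (Ordinal (ltn 3 isT)) T u) => //.
- move=> A A0; have := Tz (Sub A A0); rewrite SubK -/(volume _ _).
  (* [expeR] inverts [lne] on all of [[0, +oo]], so finiteness of the volume need not be known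
     beforehand. *)
  move/(congr1 (@expeR R)); rewrite lneK; last first.
    by rewrite in_itv/= leey andbT.
  move=> <-; rewrite /= /u; congr (expR _)%:E.
  by rewrite /conv/= !ffunE scaler0 addr0 SubK.
- by move=> A _; exact: expR_ge0.
- move=> A _; rewrite volE; congr EFin.
  rewrite /u expr2 -expRD -mulrDl (_ : 2^-1 + 2^-1 = 1) ?mul1r; last lra.
  by rewrite lnK// posrE.
Qed.
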